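(* Fix a multiplicative subgroup $G \subset \mathbb{C}^\times$, an integer $N \geq 1$, and a Hermitian matrix $A \in \mathbb{C}^{N \times N}$. There exists a coarsest partition $\pi_{\min}(A) = \{ I_1, \dots, I_m \}$ of $\{1, \dots, N\}$ such that the entries of the block submatrix $A_{I_i \times I_j}$ lie in a single $G$-orbit, for all $i, j \in \{1, \dots, m\}$. This partition is unique up to relabelling of the indices. If, moreover, $A$ is $3$-PMP and $G \subset S^1 = \{ z \in \mathbb{C} : |z| = 1\}$, then $\pi_{\min}(A) = \pi^G(A)$.
   Context: A Hermitian matrix in $\mathbb{C}^{N \times N}$ is called $3$-PMP (principal minor positive) if all its principal minors of size at most $3$ are non-negative. For $I, J \subset \{1, \dots, N\}$, $A_{I \times J}$ denotes the submatrix of $A$ with rows indexed by $I$ and columns indexed by $J$, and $A_I := A_{I \times I}$. The $G$-orbits are those of the action of $G$ on $\mathbb{C}$ by multiplication; in particular $\{0\}$ is an orbit. Partitions of $\{1, \dots, N\}$ are partially ordered by refinement; a partition with a given property is coarsest if no strictly coarser partition has the property. For a $3$-PMP matrix $A$ and a multiplicative subgroup $G \subset \mathbb{C}^\times$, $\pi^G(A)$ denotes the unique (up to relabelling) partition $\{I_1, \dots, I_m\}$ of $\{1, \dots, N\}$ such that: (a) each diagonal block $A_{I_j}$ has rank at most one, and $A_{I_j} = \mathbf{u}_j \mathbf{u}_j^*$ for a unique vector $\mathbf{u}_j \in \mathbb{C}^{|I_j|}$ with first entry in $[0, \infty)$; (b) the entries of each diagonal block $A_{I_j}$ lie in a single $G$-orbit;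 (c) the diagonal blocks have maximal size, i.e., no $I_j$ is properly contained in a set $I \subset \{1, \dots, N\}$ such that $A_I$ has rank at most one and all its entries lie in a single $G$-orbit. Existence and uniqueness of this partition is a known fact. *)

(* Defs.v *)
From HB Require Import structures.
From mathcomp Require Import all_boot all_order all_algebra.
From mathcomp Require Import sesquilinear spectral.

Set Implicit Arguments.
Unset Strict Implicit.
Unset Printing Implicit Defensive.

Import Order.TTheory GRing.Theory Num.Theory.
Local Open Scope ring_scope.
Local Open Scope sesquilinear_scope.

Section Preliminaries.
Variable C : numClosedFieldType.

Record mul_subgroup (G : C -> Prop) : Prop := MulSubgroup {
  mul_subgroup_neq0 : forall z, G z -> z != 0;
  mul_subgroup1 : G 1;
  mul_subgroupM : forall z w, G z -> G w -> G (z * w);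
  mul_subgroupV : forall z, G z -> G z^-1
}.

Definition in_orbit (G : C -> Prop) (z w : C) : Prop :=
  exists2 g, G g & w = g * z.

Definition single_orbit (G : C -> Prop) (m n : nat) (M : 'M[C]_(m, n)) : Prop :=
  exists z, forall i j, in_orbit G z (M i j).

(* [k] is the first index; [0 <= z] in [C] means that [z] is real and
   nonnegative. *)
Definition rank_one_vector (n : nat) (M : 'M[C]_n) (u : 'cV[C]_n) : Prop :=
  M = u *m u ^t* /\ forall k : 'I_n, k = 0%N :> nat -> 0 <= u k ord0.

End Preliminaries.

Section Matrices.
Variables (C : numClosedFieldType) (N : nat).
Implicit Types (A : 'M[C]_N) (I J : {set 'I_N}) (P Q : {set {set 'I_N}}).

(* [enum_val] lists the elements of a subset of ['I_N] in increasing order. *)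
Definition subblock A I J : 'M[C]_(#|I|, #|J|) := mxsub enum_val enum_val A.

Definition pmp (k : nat) A : Prop :=
  A \is hermsymmx /\
  forall I, (#|I| <= k)%N -> 0 <= \det (subblock A I I).

Definition refines P Q : bool :=
  [forall B in P, exists D in Q, B \subset D].

Definition strictly_coarser Q P : bool := refines P Q && (Q != P).

Definition block_orbit_partition (G : C -> Prop) A P : Prop :=
  partition P [set: 'I_N] /\
  forall I J, I \in P -> J \in P -> single_orbit G (subblock A I J).

(* Maximality only: there being no other coarsest partition is part of the
   theorem. *)
Definition coarsest_partition (G : C -> Prop) A P : Prop :=
  block_orbit_partition G A P /\
  forall Q, block_orbit_partition G A Q -> ~~ strictly_coarser Q P.

Record piG_conditions (G : C -> Prop) A P : Prop := PiGConditions {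
  piG_partition : partition P [set: 'I_N];
  piG_rank : forall I, I \in P ->
    (\rank (subblock A I I) <= 1)%N /\ exists! u, rank_one_vector (subblock A I I) u;
  piG_orbit : forall I, I \in P -> single_orbit G (subblock A I I);
  piG_maximal : forall I, I \in P ->
    ~ exists J : {set 'I_N}, [/\ I \proper J,
        (\rank (subblock A J J) <= 1)%N & single_orbit G (subblock A J J)]
}.

(* [P] is pi^G(A), the unique partition satisfying the conditions above. *)
Definition is_piG (G : C -> Prop) A P : Prop := unique (piG_conditions G A) P.

End Matrices.

(* Main.v *)
From mathcomp Require Import all_boot all_order all_algebra.
From mathcomp Require Import sesquilinear spectral.
From mathcomp Require Import perm boolp reals complex ring.
Require Import Defs.

(** Call two indices twins when replacing one by the other, as a row index or
    as a column index, moves no entry of A out of its G-orbit.  Since orbits are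
    the classes of an equivalence relation, so is being twins, and the coarsest
    partition is simply the partition into twin classes.  Indeed inside a pair
    of twin classes any two entries differ by a row replacement followed by a
    column replacement, so that the classes have the required property
    ([twin_partition_block_orbit]); conversely, in any partition with the
    property, two indices of the same block are twins, so that the partition
    refines the one into twin classes ([block_orbit_refines_twin]).  The latter
    is therefore the greatest such partition, which is more than being maximal
    and gives the uniqueness.

    Let now A be 3-PMP and G consist of numbers of modulus 1.  All entries of a
    diagonal block lying in one orbit have the same modulus c, and the diagonal
    ones, being non-negative, are equal to c.  Non-negativity of the minor on
    i, j and an arbitrary third index k then forces the rows of i and j to be
    proportional ([pmp_row_proportional]).  Two consequences follow.  With k in
    the block, the block has rank at most one and is determined by its first
    column ([pmp_rank_one_block]).  With k arbitrary, i and j are twins, the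
    ratio of the two rows being the ratio of two entries of the block
    ([pmp_single_orbit_twins]).  Hence a set I has a diagonal block in a single
    orbit if and only if it consists of pairwise twins, and the rank condition
    is then automatic; the sets of pairwise twins that are maximal for
    inclusion are the twin classes, so that the partition into these classes is
    the only one that can be pi^G(A), and it is one. *)

Import Order.TTheory GRing.Theory Num.Theory.

Set Implicit Arguments.
Unset Strict Implicit.
Unset Printing Implicit Defensive.

Local Open Scope ring_scope.
Local Open Scope sesquilinear_scope.

(** * Partitions ordered by refinement *)

Lemma refinesP (N : nat) (P Q : {set {set 'I_N}}) :
  reflect (forall B, B \in P -> exists2 D, D \in Q & B \subset D)
          (refines P Q).
Proof. exact: 'forall_in_exists_inP. Qed.

Lemma partition_sub_eq (T : finType) (D : {set T}) (P Q : {set {set T}}) :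
  partition P D -> partition Q D -> P \subset Q -> P = Q.
Proof.
move=> pP pQ /subsetP sPQ; apply/eqP; rewrite eqEsubset; apply/andP; split.
  exact/subsetP.
apply/subsetP => B BQ.
have /set0Pn[x xB] := partition_neq0 pQ BQ.
have xP : x \in cover P.
  by rewrite (cover_partition pP); apply: (subsetP (partitionS pQ BQ)).
have tQ := partition_trivIset pQ.
by rewrite -(def_pblock tQ BQ xB)
  (def_pblock tQ (sPQ _ (pblock_mem xP)) (_ : x \in pblock P x))
  ?pblock_mem ?mem_pblock.
Qed.

Lemma refines_anti (N : nat) (D : {set 'I_N}) (P Q : {set {set 'I_N}}) :
  partition P D -> partition Q D -> refines P Q -> refines Q P -> P = Q.
Proof.
move=> pP pQ /refinesP rPQ /refinesP rQP.
apply: (partition_sub_eq pP pQ); apply/subsetP => B BP.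
have [E EQ sBE] := rPQ _ BP; have [F FP sEF] := rQP _ EQ.
have /set0Pn[x xB] := partition_neq0 pP BP.
have tP := partition_trivIset pP.
have eBF : B = F.
  rewrite -(def_pblock tP BP xB) (def_pblock tP FP) //.
  exact/(subsetP sEF)/(subsetP sBE).
by rewrite (_ : B = E) //; apply/eqP; rewrite eqEsubset sBE /= eBF.
Qed.

(** * Twin indices and the greatest partition into single-orbit blocks *)

Section Twins.
Variables (C : numClosedFieldType) (G : C -> Prop).
Hypothesis HG : mul_subgroup G.

Lemma in_orbit_refl z : in_orbit G z z.
Proof. by exists 1; [exact: (mul_subgroup1 HG) | rewrite mul1r]. Qed.

Lemma in_orbit_sym z w : in_orbit G z w -> in_orbit G w z.
Proof.
case=> g Gg ->; exists g^-1; first exact: (mul_subgroupV HG).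
by rewrite mulKf ?(mul_subgroup_neq0 HG).
Qed.

Lemma in_orbit_trans y z w : in_orbit G y z -> in_orbit G z w -> in_orbit G y w.
Proof.
case=> g Gg -> [h Gh ->]; exists (h * g); first exact: (mul_subgroupM HG).
by rewrite mulrA.
Qed.

Variables (N : nat) (A : 'M[C]_N).

Lemma single_orbit_subblockP (I J : {set 'I_N}) :
  single_orbit G (subblock A I J) <->
  exists z, forall i j, i \in I -> j \in J -> in_orbit G z (A i j).
Proof.
split=> -[z Hz]; exists z.
  move=> i j iI jJ; have := Hz (enum_rank_in iI i) (enum_rank_in jJ j).
  by rewrite mxE !enum_rankK_in.
by move=> i j; rewrite mxE; apply: Hz; apply: enum_valP.
Qed.

(** Rows and columns have separate conditions because G need not be stable under
    complex conjugation: even for a Hermitian matrix, two entries may share an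
    orbit without their conjugates doing so. *)
Definition twins (i i' : 'I_N) : Prop :=
  forall j, in_orbit G (A i j) (A i' j) /\ in_orbit G (A j i) (A j i').

Definition twinb : rel 'I_N := fun i i' => `[< twins i i' >].

Definition twin_partition : {set {set 'I_N}} :=
  equivalence_partition twinb [set: 'I_N].

Lemma twins_refl i : twins i i.
Proof. by move=> j; split; apply: in_orbit_refl. Qed.

Lemma twins_sym i i' : twins i i' -> twins i' i.
Proof. by move=> H j; have [? ?] := H j; split; apply: in_orbit_sym. Qed.

Lemma twins_trans i2 i1 i3 : twins i1 i2 -> twins i2 i3 -> twins i1 i3.
Proof.
move=> H H' j; have [? ?] := H j; have [? ?] := H' j.
by split; [apply: (@in_orbit_trans _ (A i2 j))
          | apply: (@in_orbit_trans _ (A j i2))].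
Qed.

Lemma twinb_equiv : {in [set: 'I_N] & &, equivalence_rel twinb}.
Proof.
move=> x y z _ _ _; split; first exact/asboolP/twins_refl.
move/asboolP=> xy; apply/asboolP/asboolP => H; last exact: twins_trans xy H.
exact: twins_trans (twins_sym xy) H.
Qed.

Lemma twin_partitionP : partition twin_partition [set: 'I_N].
Proof. exact/equivalence_partitionP/twinb_equiv. Qed.

Lemma twin_partition_twins I i j :
  I \in twin_partition -> i \in I -> (j \in I <-> twins i j).
Proof.
move=> IP iI; have tP := partition_trivIset twin_partitionP.
rewrite -(def_pblock tP IP iI)
  (pblock_equivalence_partition twinb_equiv) ?inE //.
by split=> /asboolP.
Qed.

Lemma twins_sub_block (I : {set 'I_N}) :
  I != set0 -> (forall i j, i \in I -> j \in I -> twins i j) ->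
  exists2 D, D \in twin_partition & I \subset D.
Proof.
case/set0Pn=> x xI tw; exists (pblock twin_partition x).
  by rewrite pblock_mem // (cover_partition twin_partitionP) inE.
apply/subsetP => y yI.
by rewrite (pblock_equivalence_partition twinb_equiv) ?inE //;
  apply/asboolP/tw.
Qed.

(** One goes from any entry of the block to any other by replacing the row index
    by a twin, then the column index. *)
Lemma twins_single_orbit (I J : {set 'I_N}) :
    (forall i j, i \in I -> j \in I -> twins i j) ->
    (forall i j, i \in J -> j \in J -> twins i j) ->
  single_orbit G (subblock A I J).
Proof.
move=> tI tJ; apply/single_orbit_subblockP.
have [-> | /set0Pn[i0 i0I]] := eqVneq I set0.
  by exists 0 => i j; rewrite inE.
have [-> | /set0Pn[j0 j0J]] := eqVneq J set0.
  by exists 0 => i j _; rewrite inE.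
exists (A i0 j0) => i j iI jJ.
apply: (@in_orbit_trans _ (A i j0)); first by have [] := tI _ _ i0I iI j0.
by have [] := tJ _ _ j0J jJ i.
Qed.

Lemma twin_partition_pairwise I i j :
  I \in twin_partition -> i \in I -> j \in I -> twins i j.
Proof. by move=> IP iI; apply: (proj1 (twin_partition_twins j IP iI)). Qed.

Lemma twin_partition_block_orbit : block_orbit_partition G A twin_partition.
Proof.
split=> [|I J IP JP]; first exact: twin_partitionP.
by apply: twins_single_orbit => i j; apply: twin_partition_pairwise.
Qed.

(** For i and i' in one set B of Q, any index j lies in some set J of Q; the
    entries at (i, j) and (i', j) then both belong to the block B x J, and those
    at (j, i) and (j, i') to the block J x B. *)
Lemma block_orbit_refines_twin Q :
  block_orbit_partition G A Q -> refines Q twin_partition.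
Proof.
case=> pQ oQ; apply/refinesP => B BQ.
apply: twins_sub_block (partition_neq0 pQ BQ) _ => i i' iB i'B j.
have jQ : j \in cover Q by rewrite (cover_partition pQ) inE.
have jJ : j \in pblock Q j by rewrite mem_pblock.
split.
  have /single_orbit_subblockP[z Hz] := oQ _ _ BQ (pblock_mem jQ).
  by apply: (@in_orbit_trans _ z); [apply: in_orbit_sym|]; apply: Hz.
have /single_orbit_subblockP[z Hz] := oQ _ _ (pblock_mem jQ) BQ.
by apply: (@in_orbit_trans _ z); [apply: in_orbit_sym|]; apply: Hz.
Qed.

Lemma twin_partition_coarsest : coarsest_partition G A twin_partition.
Proof.
split=> [|Q oQ]; first exact: twin_partition_block_orbit.
apply/negP => /andP[rPQ /eqP neq]; apply: neq.
exact: refines_anti (proj1 oQ) twin_partitionP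
  (block_orbit_refines_twin oQ) rPQ.
Qed.

Lemma coarsest_twin_partition P :
  coarsest_partition G A P -> P = twin_partition.
Proof.
case=> oP maxP; have := maxP _ twin_partition_block_orbit.
rewrite /strictly_coarser (block_orbit_refines_twin oP) /= negbK.
by move/eqP.
Qed.

End Twins.

(** * Principal minors along arbitrary index families *)

Lemma det_mxsub_inj (R : comPzRingType) (m n : nat) (M : 'M[R]_m)
    (g : 'I_n -> 'I_m) :
  n = m -> injective g -> \det (mxsub g g M) = \det M.
Proof.
move=> e; case: m / e M g => M g inj_g.
have -> : mxsub g g M = row_perm (perm inj_g) (col_perm (perm inj_g) M).
  by apply/matrixP => i j; rewrite !mxE !permE.
rewrite row_permE col_permE !det_mulmx !det_perm odd_permV.
by rewrite mulrCA -signr_addb addbb mulr1.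
Qed.

(** Principal minors are given by subsets, but polynomial identities between
    entries are best read off matrices indexed by an explicit family f.  An
    injective f only permutes rows and columns simultaneously, and a repeated
    index produces two equal rows, hence a vanishing determinant; so coinciding
    indices need not be told apart in the applications. *)
Lemma pmp_minor_ge0 (C : numClosedFieldType) (N k n : nat) (A : 'M[C]_N)
    (f : 'I_n -> 'I_N) :
  pmp k A -> (n <= k)%N -> 0 <= \det (mxsub f f A).
Proof.
case=> _ minA le_nk.
have [/injectiveP inj_f | ] := boolP (injectiveb f); last first.
  case/injectivePn=> i [j ij fij].
  by rewrite (determinant_alternate ij) // => l; rewrite !mxE fij.
pose I := [set f x | x in 'I_n].
have cI : n = #|I| by rewrite card_imset // card_ord.
have fI x : f x \in I by apply: imset_f.
pose g (x : 'I_n) : 'I_#|I| := enum_rank_in (fI x) (f x).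
have gK x : enum_val (g x) = f x by rewrite enum_rankK_in.
have inj_g : injective g by move=> x y e; apply: inj_f; rewrite -gK e gK.
have -> : mxsub f f A = mxsub g g (subblock A I I).
  by apply/matrixP => x y; rewrite !mxE !gK.
by rewrite det_mxsub_inj // minA // -cI.
Qed.

Lemma det_mx22 (R : comPzRingType) (M : 'M[R]_2) :
  \det M = M 0 0 * M 1 1 - M 0 1 * M 1 0.
Proof.
rewrite (expand_det_row _ 0) !big_ord_recl big_ord0 /cofactor !det_mx11 !mxE.
have -> : lift 0 0 = 1 :> 'I_2 by apply: val_inj.
have -> : lift 1 0 = 0 :> 'I_2 by apply: val_inj.
by rewrite /= expr0 expr1 addr0 mul1r mulN1r mulrN.
Qed.

Lemma det_mx33 (R : comPzRingType) (M : 'M[R]_3) (k := ord_max) :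
  \det M = M 0 0 * (M 1 1 * M k k - M 1 k * M k 1)
         - M 0 1 * (M 1 0 * M k k - M 1 k * M k 0)
         + M 0 k * (M 1 0 * M k 1 - M 1 1 * M k 0).
Proof.
rewrite {}/k.
rewrite (expand_det_row _ 0) !big_ord_recl big_ord0 /cofactor !det_mx22 !mxE.
have -> : lift 0 (lift 0 0) = ord_max :> 'I_3 by apply: val_inj.
have -> : lift 0 0 = 1 :> 'I_3 by apply: val_inj.
have -> : lift 0 1 = ord_max :> 'I_3 by apply: val_inj.
have -> : lift 1 0 = 0 :> 'I_3 by apply: val_inj.
have -> : lift 1 1 = ord_max :> 'I_3 by apply: val_inj.
have -> : lift ord_max 0 = 0 :> 'I_3 by apply: val_inj.
have -> : lift ord_max 1 = 1 :> 'I_3 by apply: val_inj.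
rewrite [(0 + ord0)%N]/= [(0 + 1)%N]/= [(0 + ord_max)%N]/= expr0 expr1 sqrrN.
ring.
Qed.

(** * Positivity of the minors of size at most three *)

Section PrincipalMinors.
Variables (C : numClosedFieldType) (N : nat) (A : 'M[C]_N).
Hypothesis pmpA : pmp 3 A.

Lemma pmp_herm i j : A j i = (A i j)^*.
Proof.
have [/is_hermitianmxP hA _] := pmpA.
by rewrite [in LHS]hA expr0 scale1r !mxE.
Qed.

Lemma pmp_diag_ge0 i : 0 <= A i i.
Proof.
have := pmp_minor_ge0 (fun _ : 'I_1 => i) pmpA isT.
by rewrite det_mx11 mxE.
Qed.

Lemma pmp_zero_diag i k : A i i = 0 -> A i k = 0.
Proof.
move=> Aii; pose f (x : 'I_2) := nth i [:: i; k] x.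
have := pmp_minor_ge0 f pmpA isT.
rewrite det_mx22 !mxE /f /= Aii mul0r sub0r oppr_ge0 (pmp_herm i k) -normCK.
move=> le0; apply/eqP; rewrite -normr_eq0 -sqrf_eq0.
by rewrite eq_le le0 exprn_ge0.
Qed.

(** The minor on the indices i, j, k, multiplied by c, equals minus the square
    of the modulus of the difference of both sides.  Conceptually, the block on
    i and j is singular, and a kernel vector of a principal block of a positive
    semidefinite matrix stays in the kernel once padded with zeros. *)
Lemma pmp_row_proportional c i j k :
  A i i = c -> A j j = c -> `|A i j| = c -> c * A i k = A i j * A j k.
Proof.
move=> Aii Ajj nAij.
have c_ge0 : 0 <= c by rewrite -Aii pmp_diag_ge0.
have c_sqr : c ^+ 2 = A i j * (A i j)^* by rewrite -normCK nAij.
pose f (x : 'I_3) := nth i [:: i; j; k] x.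
have := pmp_minor_ge0 f pmpA isT.
rewrite det_mx33 !mxE /f /= => /(mulr_ge0 c_ge0).
rewrite Aii Ajj (pmp_herm i j) (pmp_herm i k) (pmp_herm j k).
set a := A i j in c_sqr *; set b := A i k; set d := A j k; set e := A k k.
set D := (X in 0 <= X) => D_ge0.
have cc : c^* = c by apply: geC0_conj.
have DE : D = - `|c * b - a * d| ^+ 2.
  rewrite normCK rmorphB !rmorphM /= cc.
  have -> : D = c ^+ 2 * (c * e - d * d^*) - (a * a^*) * c * e
      + c * a * d * b^* + c * b * a^* * d^* - c ^+ 2 * (b * b^*).
    by rewrite /D; ring.
  rewrite -c_sqr.
  have -> : (c * b - a * d) * (c * b^* - a^* * d^*)
      = c ^+ 2 * (b * b^*) - c * b * a^* * d^* - c * a * d * b^*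
      + (a * a^*) * (d * d^*) by ring.
  by rewrite -c_sqr; ring.
apply/eqP; rewrite -subr_eq0 -normr_eq0 -sqrf_eq0 eq_le exprn_ge0 // andbT.
by rewrite -oppr_ge0 -DE.
Qed.

End PrincipalMinors.

(** * Vectors generating a matrix of rank one *)

Lemma rank_one_vector_rank (C : numClosedFieldType) (n : nat) (M : 'M[C]_n) u :
  rank_one_vector M u -> (\rank M <= 1)%N.
Proof.
by case=> -> _; apply: leq_trans (mxrankM_maxl _ _) (rank_leq_col _).
Qed.

(** The vector is forced to be the first column divided by the square root
    of c.  When c = 0 this reads 0 thanks to the convention x / 0 = 0, which is
    the right value since M is then zero. *)
Lemma exists_unique_rank_one_vector (C : numClosedFieldType) (n : nat)
    (M : 'M[C]_n) (c : C) (k0 : 'I_n) :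
    k0 = 0%N :> nat ->
    (forall i j, M j i = (M i j)^*) ->
    (forall i, M i i = c) -> 0 <= c -> (c = 0 -> M = 0) ->
    (forall i j k, c * M i k = M i j * M j k) ->
  exists! u, rank_one_vector M u.
Proof.
move=> k00 hM Mii c_ge0 c0M prop.
have s_ge0 : 0 <= sqrtC c by rewrite sqrtC_ge0.
have sconj : (sqrtC c)^* = sqrtC c by apply: geC0_conj.
have mulE (u v : 'cV[C]_n) i j : (u *m v ^t*) i j = u i 0 * (v j 0)^*.
  by rewrite mxE big_ord1 !mxE.
exists (\col_i (M i k0 / sqrtC c)); split.
  split=> [|k kk0]; last first.
    rewrite (_ : k = k0) ?mxE ?Mii ?divr_ge0 //.
    by apply: val_inj; rewrite /= kk0.
  apply/matrixP => i j; rewrite mulE !mxE.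
  have [c0 | c_neq0] := eqVneq c 0; first by rewrite c0M // !mxE !mul0r.
  rewrite rmorphM /= fmorphV /= sconj -hM mulrACA -prop -invfM -expr2 sqrtCK.
  by rewrite mulrAC divff ?mul1r.
move=> v [Mv v_ge0]; have Mij i j : M i j = v i 0 * (v j 0)^*.
  by rewrite [in LHS]Mv mulE.
apply/matrixP => i j; rewrite (ord1 j) mxE.
have [c0 | c_neq0] := eqVneq c 0.
  rewrite c0 sqrtC0 invr0 mulr0; apply/esym/eqP.
  by rewrite -mul_conjC_eq0 -Mij Mii c0.
have vk0 : v k0 0 = sqrtC c.
  rewrite -(Mii k0) Mij (geC0_conj (v_ge0 _ k00)) -expr2 sqrCK //.
  exact: v_ge0.
by rewrite Mij vk0 sconj mulfK // sqrtC_eq0.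
Qed.

(** * Twin classes of a matrix with non-negative small minors *)

Section PMPTwins.
Variables (C : numClosedFieldType) (G : C -> Prop).
Hypothesis HG : mul_subgroup G.
Hypothesis G1 : forall z, G z -> `|z| = 1.
Variables (N : nat) (A : 'M[C]_N).
Hypothesis pmpA : pmp 3 A.

Lemma in_orbit_norm z w : in_orbit G z w -> `|w| = `|z|.
Proof. by case=> g /G1 g1 ->; rewrite normrM g1 mul1r. Qed.

Lemma single_orbit_norm (I : {set 'I_N}) :
  single_orbit G (subblock A I I) ->
  exists2 c : C, 0 <= c & forall i j, i \in I -> j \in I -> `|A i j| = c.
Proof.
move/single_orbit_subblockP=> [z Hz]; exists `|z| => // i j iI jI.
by apply: in_orbit_norm; apply: Hz.
Qed.

Lemma pmp_norm_diag c i : `|A i i| = c -> A i i = c.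
Proof. by rewrite ger0_norm // pmp_diag_ge0. Qed.

(** A condition on the block alone controls whole rows of A: the rows of i and j
    are proportional, with ratio A j i / A i i, which belongs to G because both
    entries come from the block.  If the diagonal vanishes, both rows are zero.
    Columns follow by conjugation, which is inversion on G. *)
Lemma pmp_single_orbit_twins (I : {set 'I_N}) i j :
  single_orbit G (subblock A I I) -> i \in I -> j \in I -> twins G A i j.
Proof.
move=> oI iI jI.
have [c c_ge0 nA] := single_orbit_norm oI.
have [Aii Ajj] : A i i = c /\ A j j = c by split; apply/pmp_norm_diag/nA.
have row k : exists2 g, G g & A j k = g * A i k.
  have [c0 | c_neq0] := eqVneq c 0.
    exists 1; first exact: (mul_subgroup1 HG).
    rewrite (pmp_zero_diag pmpA k (_ : A j j = 0)) ?Ajj //.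
    by rewrite (pmp_zero_diag pmpA k (_ : A i i = 0)) ?Aii // mulr0.
  have [g Gg Aji] : in_orbit G (A i i) (A j i).
    have /single_orbit_subblockP[z Hz] := oI.
    by apply: (@in_orbit_trans _ _ HG _ z); [apply: in_orbit_sym|]; auto.
  exists g => //; apply: (mulfI c_neq0).
  rewrite (pmp_row_proportional pmpA k Ajj Aii) ?nA // Aji Aii.
  by rewrite mulrAC [RHS]mulrC.
move=> k; have [g Gg Ajk] := row k; split; first by exists g.
exists g^-1; first exact: (mul_subgroupV HG).
rewrite !(pmp_herm pmpA _ k) Ajk rmorphM /=.
by rewrite invC_norm G1 // expr1n invr1 mul1r.
Qed.

Lemma pmp_rank_one_block (I : {set 'I_N}) :
  I != set0 -> single_orbit G (subblock A I I) ->
  exists! u, rank_one_vector (subblock A I I) u.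
Proof.
rewrite -card_gt0 => I_gt0 oI.
have [c c_ge0 nA] := single_orbit_norm oI.
apply: (@exists_unique_rank_one_vector _ _ _ c (Ordinal I_gt0)) => //.
- by move=> i j; rewrite !mxE (pmp_herm pmpA).
- by move=> i; rewrite !mxE; apply/pmp_norm_diag/nA; apply: enum_valP.
- move=> c0; apply/matrixP => i j; rewrite !mxE; apply/eqP.
  by rewrite -normr_eq0 nA ?c0 //; apply: enum_valP.
move=> i j k; rewrite !mxE.
by apply: (pmp_row_proportional pmpA);
  [apply/pmp_norm_diag/nA | apply/pmp_norm_diag/nA | apply: nA];
  apply: enum_valP.
Qed.

Lemma pmp_rank_block (I : {set 'I_N}) :
  I != set0 -> single_orbit G (subblock A I I) ->
  (\rank (subblock A I I) <= 1)%N.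
Proof.
by move=> I0 /(pmp_rank_one_block I0)[u [/rank_one_vector_rank]].
Qed.

Lemma twin_partition_piG : piG_conditions G A (twin_partition G A).
Proof.
have pP := twin_partitionP HG A.
have oP I : I \in twin_partition G A -> single_orbit G (subblock A I I).
  by move=> IP; apply: (proj2 (twin_partition_block_orbit HG A)).
split=> //.
  move=> I IP; have I0 := partition_neq0 pP IP.
  by split; [exact: pmp_rank_block (oP _ IP)
            | exact: pmp_rank_one_block (oP _ IP)].
move=> I IP [J [/properP[sIJ [j jJ jNI]] _ oJ]].
have /set0Pn[i iI] := partition_neq0 pP IP.
move/negP: jNI; apply; apply/(twin_partition_twins HG j IP iI).
exact: pmp_single_orbit_twins oJ (subsetP sIJ _ iI) jJ.
Qed.

Lemma piG_twin_partition P : piG_conditions G A P -> P = twin_partition G A.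
Proof.
case=> pP _ oP maxP; have pT := twin_partitionP HG A.
(* Maximality forbids a block to be strictly smaller than its twin class. *)
apply: (partition_sub_eq pP pT); apply/subsetP => B BP.
have [D DT sBD] := twins_sub_block HG (partition_neq0 pP BP)
  (fun i j => @pmp_single_orbit_twins B i j (oP _ BP)).
have [-> // | neqBD] := eqVneq B D; case: (maxP _ BP); exists D.
have oD : single_orbit G (subblock A D D).
  by apply: (proj2 (twin_partition_block_orbit HG A)).
split=> //; first by rewrite properEneq neqBD.
exact: pmp_rank_block (partition_neq0 pT DT) oD.
Qed.

End PMPTwins.

(** * The coarsest partition and pi^G *)

Theorem proposition4p6 (R : realType) (G : R[i] -> Prop) (HG : mul_subgroup G)
  (N : nat) (HN : (1 <= N)%N) (A : 'M[R[i]]_N) (HA : A \is hermsymmx) :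
  exists pi_min : {set {set 'I_N}},
    [/\ coarsest_partition G A pi_min,
        forall P : {set {set 'I_N}}, coarsest_partition G A P -> P = pi_min
      & pmp 3 A -> (forall z, G z -> `|z| = 1) -> is_piG G A pi_min].
Proof.
exists (twin_partition G A); split.
- exact: twin_partition_coarsest.
- by move=> P; apply: coarsest_twin_partition.
move=> pmpA G1; split; first exact: twin_partition_piG.
by move=> P /(piG_twin_partition HG G1 pmpA).
Qed.
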